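(* Let $\alpha>0$. Then as $\beta\to\alpha$ (with $\beta>0$), $$\dim_{\mathrm H}\{x\in[0,1]:\theta_{M_\beta,M_\alpha}'(x)\neq0\}\to 1,$$ where $\theta_{M_\beta,M_\alpha}$ is the topological conjugacy between the Manneville–Pomeau maps $M_\beta$ and $M_\alpha$.
   Context: For $0<\alpha<\infty$, the Manneville–Pomeau map $M_\alpha:[0,1]\to[0,1]$ is $M_\alpha(x)=x+x^{1+\alpha}\bmod 1$. The topological conjugacy $\theta=\theta_{M_\beta,M_\alpha}$ between $M_\beta$ and $M_\alpha$ is the increasing homeomorphism $\theta:[0,1]\to[0,1]$ with $\theta\circ M_\beta=M_\alpha\circ\theta$. The set $\{x:\theta'(x)\ne0\}$ is the set of $x$ for which it is not the case that $\theta'(x)$ exists and equals $0$; it thus includes points where the derivative does not exist or is infinite. $\dim_{\mathrm H}$ is Hausdorff dimension. *)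

(* Defs.v *)
From HB Require Import structures.
From mathcomp Require Import all_boot all_order all_algebra.
From mathcomp Require Import all_classical all_reals all_analysis.

Set Implicit Arguments.
Unset Strict Implicit.
Unset Printing Implicit Defensive.

Import Order.TTheory GRing.Theory Num.Theory.
Import numFieldTopology.Exports numFieldNormedType.Exports.

Local Open Scope classical_set_scope.
Local Open Scope ring_scope.

(* "mod 1" is the fractional part, so the right endpoint 1 is sent to 0. *)
Definition manneville_pomeau (R : realType) (a x : R) : R :=
  let y := x + x `^ (1 + a) in y - (Num.floor y)%:~R.

(* Self-maps of [0, 1] are represented by functions R -> R, of which only the
   restriction to [0, 1] is constrained. *)
Definition increasing_homeo01 (R : realType) (h : R -> R) : Prop :=
  {in `[0, 1] &, {homo h : x y / x < y}} /\
  set_fun `[0, 1] `[0, 1] h /\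
  {within `[0, 1], continuous h} /\
  exists g : R -> R,
    [/\ set_fun `[0, 1] `[0, 1] g,
        {within `[0, 1], continuous g},
        {in `[0, 1], cancel h g} &
        {in `[0, 1], cancel g h}].

Definition is_conjugacy01 (R : realType) (S T h : R -> R) : Prop :=
  increasing_homeo01 h /\ {in `[0, 1], forall x, h (S x) = T (h x)}.

(* The derivative at x of the restriction of f to [0, 1] (hence one-sided at
   the endpoints) exists and equals l. *)
Definition has_deriv01 (R : realType) (f : R -> R) (x l : R) : Prop :=
  (f y - f x) / (y - x) @[y --> within `[0, 1] x^'] --> l.

Definition nonzero_deriv_set01 (R : realType) (f : R -> R) : set R :=
  [set x | x \in `[0, 1] /\ ~ has_deriv01 f x 0].

Section Hausdorff.
Local Open Scope ereal_scope.

(* The diameter of the empty set is -oo here. *)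
Definition diam (R : realType) (U : set R) : \bar R :=
  ereal_sup [set (`|p.1 - p.2|%R)%:E | p in U `*` U].

(* The case of the empty set matters only for s = 0, as 0 `^ 0 = 1. *)
Definition hausdorff_gauge (R : realType) (s : R) (U : set R) : \bar R :=
  if U == set0 then 0 else diam U `^ s.

Definition hausdorff_content (R : realType) (s d : R) (A : set R) : \bar R :=
  ereal_inf [set \sum_(0 <= i <oo) hausdorff_gauge s (U i) |
    U in [set U : (set R)^nat | A `<=` \bigcup_i U i /\
                                forall i, diam (U i) <= d%:E]].

Definition hausdorff_measure (R : realType) (s : R) (A : set R) : \bar R :=
  ereal_sup [set hausdorff_content s d A | d in [set d : R | (0 < d)%R]].

Definition hausdorff_dim (R : realType) (A : set R) : \bar R :=
  ereal_inf [set s%:E | s in [set s : R | (0 <= s)%R /\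
                                          hausdorff_measure s A = 0]].

End Hausdorff.

(* Main.v *)
Require Import Defs.
From mathcomp Require Import all_boot all_order all_algebra.
From mathcomp Require Import all_classical all_reals all_analysis.
From mathcomp Require Import ring lra.
Import Order.TTheory GRing.Theory Num.Theory.
Import numFieldTopology.Exports numFieldNormedType.Exports.
Local Open Scope classical_set_scope.
Local Open Scope ring_scope.

(* Let B be the set of points where theta' = 0. Then theta(B) is Lebesgue
   null, so theta maps the complement A of B onto a set of full measure. If
   theta is s-Hoelder, H^t(A) = 0 with t < s would make theta(A) null too; hence
   dim A >= s, and it suffices that the Hoelder exponent of theta tends to 1.

   The function psi(x) = k x^(beta/alpha), k < 1, satisfies
   M_alpha o psi <= psi o M_beta on each branch when beta is close to alpha. If
   theta(x) < psi(x) somewhere, the gap psi - theta would grow geometrically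
   along the orbit of x, which is absurd; so theta >= psi, and the same argument
   for theta^-1 gives theta(x) <= C x^(beta/alpha).

   Consequently M_beta'(y)^s <= M_alpha'(theta x) for x <= y <= kappa x with
   some kappa > 1. Applying both maps to a pair x < y in one branch can then only
   increase (theta y - theta x) / (y - x)^s, while the pair expands, so that it
   ends up either with y > kappa x, where the bound on theta at 0 applies, or
   straddling the discontinuity c, where the pair is split at c. *)

Set Implicit Arguments.
Unset Strict Implicit.
Unset Printing Implicit Defensive.

(** * Bernoulli inequalities for real powers, and the lift x + x^(1+a) *)

Section RealPowers.
Variable R : realType.
Implicit Types a b p q s t x y k : R.

(** Bernoulli's inequality from ln u <= u - 1: with m the right-hand side, t/m and 1/m have mean 1
    for the weights b and 1 - b. *)
Lemma powR_le_tangent1 b t : 0 <= t -> 0 < b <= 1 -> t `^ b <= 1 + b * (t - 1).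
Proof.
rewrite le_eqVlt => /orP[/eqP<- /andP[b0 b1]|t0 /andP[b0 b1]].
  by rewrite powR0 ?gt_eqF//; lra.
have m0 : 0 < 1 + b * (t - 1) by nra.
have ln1 x : 0 < x -> ln x <= x - 1.
  by move=> x0; rewrite -[in ln x](subrKC 1 x); apply: le_ln1Dx; lra.
rewrite -ler_ln ?posrE ?powR_gt0// ln_powR.
set m := 1 + _ in m0 *.
have im0 : 0 < m^-1 by rewrite invr_gt0.
have := ln1 (t / m) (divr_gt0 t0 m0).
have := ln1 m^-1 im0.
rewrite lnM ?posrE// lnV ?posrE// => h2 h1.
have e : b * (t / m) + (1 - b) * m^-1 = 1.
  rewrite mulrA -mulrDl -[RHS](divff (lt0r_neq0 m0)); congr (_ / _).
  by rewrite /m; ring.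
suff : b * ln t - ln m <= 0 by lra.
have : b * (ln t - ln m) <= b * (t / m - 1) by rewrite ler_pM2l.
have : (1 - b) * (- ln m) <= (1 - b) * (m^-1 - 1) by rewrite ler_wpM2l//; lra.
lra.
Qed.

Lemma powR_ge_tangent1 b t : 0 <= t -> 1 <= b -> 1 + b * (t - 1) <= t `^ b.
Proof.
move=> t0 b1; have b0 : 0 < b by lra.
have ib : 0 < b^-1 <= 1 by rewrite invr_gt0 b0 invf_le1.
have := powR_le_tangent1 (powR_ge0 t b) ib.
rewrite -powRrM divff ?gt_eqF// powRr1// => h.
have : b * t <= b * (1 + b^-1 * (t `^ b - 1)) by rewrite ler_pM2l.
rewrite mulrDr mulrA divff ?gt_eqF//; lra.
Qed.

(** The tangent at 1 bounds the difference by |b - 1| (1 - t). Uniformity in t is what the right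
    branch requires. *)
Lemma powR_sub_id b t : 0 <= t <= 1 -> 0 < b -> `|t `^ b - t| <= `|b - 1|.
Proof.
move=> /andP[t0 t1] b0; have [b1|/ltW b1] := leP b 1.
  have h := powR_le_tangent1 t0 (introT andP (conj b0 b1)).
  have h' : t <= t `^ b.
    move: t0; rewrite le_eqVlt => /orP[/eqP<-|t0]; first exact: powR_ge0.
    by apply: ger1_powR => //; rewrite t0.
  rewrite ger0_norm ?subr_ge0// ler0_norm ?subr_le0//; nra.
have h := powR_ge_tangent1 t0 b1.
have h' : t `^ b <= t.
  move: t0; rewrite le_eqVlt => /orP[/eqP<-|t0].
    by rewrite powR0// gt_eqF.
  by apply: ge1r_powR => //; rewrite t0.
rewrite ler0_norm ?subr_le0// ger0_norm ?subr_ge0//; nra.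
Qed.

(** For b < 1, write (1 + t)^b as 1 + t divided by (1 + t)^(1 - b) <= 1 + (1 - b) t; the room 1 -
    sigma absorbs this loss. *)
Lemma powR_1D_ge b t sigma : 0 <= t <= 1 -> 0 < b -> 0 <= sigma <= 1 ->
  `|b - 1| <= (1 - sigma) / 2 -> 1 + sigma * t <= (1 + t) `^ b.
Proof.
move=> /andP[t0 t1] b0 /andP[s0 s1] hb; have [b1|/ltW b1] := leP b 1; last first.
  apply: (@le_trans _ _ (1 + t)); last by apply: le1r_powR => //; lra.
  nra.
move: hb; rewrite ler0_norm ?subr_le0// => hb.
have h0 : 0 < (1 + t) `^ b by rewrite powR_gt0//; lra.
have c1 : (1 + t) `^ (1 - b) <= 1 + (1 - b) * t.
  have [->|bn1] := eqVneq b 1; first by rewrite subrr powRr0; lra.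
  have := @powR_le_tangent1 (1 - b) (1 + t).
  rewrite (_ : 1 + t - 1 = t); last by ring.
  apply; first lra.
  by rewrite subr_gt0 lt_neqAle bn1 b1; lra.
have : 1 + t <= (1 + t) `^ b * (1 + (1 - b) * t).
  have e : (1 + t) `^ b * (1 + t) `^ (1 - b) = 1 + t.
    rewrite -powRD; last by apply/implyP => _; rewrite gt_eqF//; lra.
    by rewrite subrKC powRr1//; lra.
  by rewrite -{1}e ler_pM2l.
have ct : (1 - b) * t <= 1 - b by nra.
have sct : sigma * ((1 - b) * t) <= 1 - b by nra.
have h : (1 + sigma * t) * (1 + (1 - b) * t) <= 1 + t by nra.
by move=> /(le_trans h); rewrite ler_pM2r//; nra.
Qed.

Lemma powR1D a x : 0 < a -> 0 <= x -> x `^ (1 + a) = x * x `^ a.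
Proof.
move=> a0 x0; rewrite powRD ?powRr1//; apply/implyP => /eqP h.
by exfalso; lra.
Qed.

Lemma powR_tangent a p q : 0 < a -> 0 <= p -> 0 <= q ->
  (1 + a) * q `^ a * (p - q) <= p `^ (1 + a) - q `^ (1 + a).
Proof.
move=> a0 p0; rewrite le_eqVlt => /orP[/eqP<-|q0].
  rewrite powR0 ?gt_eqF// mulr0 mul0r powR0 ?gt_eqF//; last lra.
  by rewrite subr0 powR_ge0.
have h := @powR_ge_tangent1 (1 + a) (p / q) (divr_ge0 p0 (ltW q0)) ltac:(lra).
have e : p `^ (1 + a) = (p / q) `^ (1 + a) * q `^ (1 + a).
  by rewrite -powRM ?(divr_ge0 p0) ?(ltW q0)// divfK// gt_eqF.
have e2 : q `^ (1 + a) = q * q `^ a.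
  by rewrite powR1D// ltW.
have e3 : (1 + a) * q `^ a * (p - q) = (1 + a) * (p / q - 1) * q `^ (1 + a).
  by rewrite e2; field; rewrite gt_eqF.
rewrite e e3 -[X in _ <= _ - X]mul1r -mulrBl ler_wpM2r ?powR_ge0//; lra.
Qed.

(** The lift of [manneville_pomeau] before reduction mod 1; the right branch is this function minus
    1. *)
Definition left_branch a x := x + x `^ (1 + a).

Lemma left_branch1 a : left_branch a 1 = 2.
Proof. by rewrite /left_branch powR1. Qed.

Lemma left_branch_ge a p q : 0 < a -> 0 <= p -> 0 <= q ->
  (1 + (1 + a) * q `^ a) * (p - q) <= left_branch a p - left_branch a q.
Proof.
by move=> a0 p0 q0; have := powR_tangent a0 p0 q0; rewrite /left_branch; lra.
Qed.

Lemma left_branch_le a p q : 0 < a -> 0 <= p -> 0 <= q ->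
  left_branch a p - left_branch a q <= (1 + (1 + a) * p `^ a) * (p - q).
Proof. by move=> a0 p0 q0; have := left_branch_ge a0 q0 p0; lra. Qed.

(** Since q^a <= p^a, p p^a - q q^a >= p^a (p - q). The factor involves the larger point and p >= p
    - q, so a gap bounded below expands by a definite factor even when q = 0. *)
Lemma left_branch_expand a p q : 0 < a -> 0 <= q <= p ->
  (1 + p `^ a) * (p - q) <= left_branch a p - left_branch a q.
Proof.
move=> a0 /andP[q0 qp]; have p0 := le_trans q0 qp.
have : q `^ a <= p `^ a by apply: ge0_ler_powR => //; rewrite ?nnegrE// ltW.
by rewrite /left_branch !powR1D//; nra.
Qed.

Lemma left_branch_lt a p q : 0 < a -> 0 <= q < p -> left_branch a q < left_branch a p.
Proof.
move=> a0 /andP[q0 qp]; have := @left_branch_expand a p q a0.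
by rewrite q0 ltW// => /(_ isT); have := powR_ge0 p a; nra.
Qed.

Lemma left_branch_mono a p q : 0 < a -> 0 <= q <= p -> left_branch a q <= left_branch a p.
Proof.
move=> a0 /andP[q0]; rewrite le_eqVlt => /orP[/eqP->//|qp].
by rewrite ltW// left_branch_lt// q0.
Qed.
End RealPowers.

(** Starting from a value at least d, n steps reach at least d (1 + n e), which exceeds 1 once n > 1
    / (d e). The type [T] is instantiated with points and with pairs of points. *)
Lemma no_expansion (R : realType) T (P : T -> Prop) (q : T -> R) (e d : R) :
  0 < e -> 0 < d -> (forall t, P t -> q t <= 1) ->
  (forall t, P t -> d <= q t -> exists2 t', P t' & (1 + e) * q t <= q t') ->
  forall t, P t -> q t < d.
Proof.
move=> e0 d0 q1 step t Pt; rewrite ltNge; apply/negP => dt.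
have iter n : exists2 t', P t' & d * (1 + n%:R * e) <= q t'.
  elim: n => [|n [t' Pt' ht']]; first by exists t => //; lra.
  have nn : 0 <= n%:R :> R by [].
  have ne : 0 <= n%:R * e by rewrite mulr_ge0// ltW.
  have dt' : d <= q t' by apply: le_trans ht'; nra.
  have [t'' Pt'' ht''] := step _ Pt' dt'; exists t'' => //.
  apply: le_trans ht''; rewrite -natr1; nra.
have [n hn] : exists n : nat, (d * e)^-1 < n%:R.
  by exists (Num.Def.truncn (d * e)^-1).+1; rewrite truncnS_gt.
have [t' /q1 h1 h2] := iter n.
have de : 0 < d * e by rewrite mulr_gt0.
have : 1 < n%:R * (d * e) by rewrite -ltr_pdivrMr// div1r.
nra.
Qed.

(** * The two branches, and the conjugacy equation on each of them *)

Section Branches.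
Variable R : realType.
Implicit Types a b c x y z : R.

Lemma left_branch_eq1 a : 0 < a -> exists2 c, 0 < c < 1 & left_branch a c = 1.
Proof.
(* Starting at 1/2 keeps x positive, where the power is differentiable; the lift is at most 1 at 1/2
   and equals 2 at 1. *)
move=> a0; have cf : {within `[2^-1, 1], continuous (left_branch a)}.
  apply: derivable_within_continuous => x; rewrite in_itv/= => /andP[x0 _].
  apply: derivableD; first exact: derivable_id.
  by apply: derivable_powR; rewrite in_itv/= andbT; lra.
have h2 : left_branch a 2^-1 <= 1.
  have : (2^-1 : R) `^ (1 + a) <= 2^-1 by apply: ge1r_powR; lra.
  by rewrite /left_branch; lra.
have h1 := left_branch1 a.
have [|c + fc] := @IVT R (left_branch a) 2^-1 1 1 ltac:(lra) cf.
  by rewrite ge_min h2/= le_max h1 orbC/=; lra.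
rewrite in_itv/= => /andP[c0 c1]; exists c => //.
apply/andP; split; first lra.
rewrite lt_neqAle c1 andbT.
by apply/eqP => c1'; move: fc; rewrite c1' h1; lra.
Qed.

Lemma manneville_pomeauE a x (n : int) : n%:~R <= left_branch a x < (n + 1)%:~R ->
  manneville_pomeau a x = left_branch a x - n%:~R.
Proof. by move=> /floor_def e; rewrite /manneville_pomeau /= -/(left_branch a x) e. Qed.

Lemma manneville_pomeau_left a c x : 0 < a -> left_branch a c = 1 ->
  0 <= x < c -> manneville_pomeau a x = left_branch a x.
Proof.
move=> a0 fc /andP[x0 xc]; rewrite (@manneville_pomeauE _ _ 0) ?subr0//=.
rewrite add0r -[X in _ < X]fc left_branch_lt ?x0// andbT.
by rewrite addr_ge0// powR_ge0.
Qed.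

Lemma manneville_pomeau_right a c x : 0 < a -> 0 < c -> left_branch a c = 1 ->
  c <= x < 1 -> manneville_pomeau a x = left_branch a x - 1.
Proof.
move=> a0 c0 fc /andP[cx x1]; rewrite (@manneville_pomeauE _ _ 1)//=.
rewrite -[X in X <= _]fc left_branch_mono ?cx ?(ltW c0)//=.
rewrite (_ : (1 + 1)%:~R = 2)// -(left_branch1 a) left_branch_lt// x1 andbT; lra.
Qed.

(* The left branch is taken on the closed interval [0, c], with value 1 at c, so
   that both junctions are covered by continuity. *)
Record branch_conj b a (h : R -> R) c : Prop := BranchConj {
  bc_homo : forall x y, 0 <= x -> x < y -> y <= 1 -> h x < h y;
  bc_0 : h 0 = 0;
  bc_1 : h 1 = 1;
  bc_c : 0 < c < 1;
  bc_fc : left_branch b c = 1;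
  bc_left : forall x, 0 <= x <= c ->
    h (left_branch b x) = left_branch a (h x);
  bc_right : forall x, c <= x <= 1 ->
    h (left_branch b x - 1) = left_branch a (h x) - 1 }.

Lemma increasing_homeo01_ends (h : R -> R) : increasing_homeo01 h -> h 0 = 0 /\ h 1 = 1.
Proof.
move=> [hi [hm [_ [g [gm _ _ hg]]]]].
have mono x y : 0 <= x -> x < y -> y <= 1 -> h x < h y.
  by move=> *; apply: hi; rewrite ?in_itv//=; lra.
have i0 : (0 : R) \in `[0, 1] by rewrite in_itv/=; lra.
have i1 : (1 : R) \in `[0, 1] by rewrite in_itv/=; lra.
have := gm 0 i0; have := gm 1 i1; have := hm 0 i0; have := hm 1 i1.
rewrite /= !in_itv/= => /andP[? ?] /andP[? ?] /andP[? ?] /andP[? ?].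
split.
  have [g0|g0] := leP (g 0) 0.
    by rewrite -[RHS]hg//; congr h; lra.
  have : h 0 < h (g 0) by apply: mono; lra.
  by rewrite hg//; lra.
have [g1|g1] := leP 1 (g 1).
  by rewrite -[RHS]hg//; congr h; lra.
have : h (g 1) < h 1 by apply: mono; lra.
by rewrite hg//; lra.
Qed.

(** The inverse g is returned too, as a conjugacy with a and b exchanged, so that a lower bound for
    g becomes an upper bound for h. *)
Lemma conjugacy_branch_conj b a (h : R -> R) : 0 < b -> 0 < a ->
  is_conjugacy01 (manneville_pomeau b) (manneville_pomeau a) h ->
  exists2 c, branch_conj b a h c &
   exists2 g, branch_conj a b g (h c) & forall x, 0 <= x <= 1 -> g (h x) = x.
Proof.
move=> b0 a0 [hh hc].
have [h0 h1] := increasing_homeo01_ends hh.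
have [hi [hm [_ [g [gm _ gh hg]]]]] := hh.
have mono x y : 0 <= x -> x < y -> y <= 1 -> h x < h y.
  by move=> *; apply: hi; rewrite ?in_itv//=; lra.
have hcE x : 0 <= x <= 1 -> h (manneville_pomeau b x) = manneville_pomeau a (h x).
  by move=> ?; apply: hc; rewrite in_itv.
have [c c01 fc] := left_branch_eq1 b0.
have [c' c'01 fc'] := left_branch_eq1 a0.
have hm' x : 0 <= x <= 1 -> 0 <= h x <= 1.
  by move=> ?; have := hm x; rewrite /= !in_itv/= => /(_ _); apply.
have hcc : 0 < h c < 1.
  have := mono 0 c; have := mono c 1; rewrite h0 h1.
  by move=> H1 H2; rewrite H1 ?H2//; lra.
have mpc : manneville_pomeau b c = 0.
  by rewrite (@manneville_pomeau_right _ c) ?fc ?subrr//; lra.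
(* The image h c is a zero of the map with parameter a inside (0, 1), and c' is the only one: left
   of c' the value is positive, right of it the lift exceeds 1. *)
have hcc' : h c = c'.
  have := hcE c; rewrite mpc h0 => /(_ _)/esym e.
  have [lt|ge] := ltP (h c) c'.
    move: e; rewrite (@manneville_pomeau_left _ c')//; last by lra.
    move=> e; have := powR_ge0 (h c) (1 + a); have := e ltac:(lra).
    by rewrite /left_branch; lra.
  move: ge; rewrite le_eqVlt => /orP[/eqP//|lt].
  move: e; rewrite (@manneville_pomeau_right _ c')//; try by lra.
  move=> e; have := @left_branch_lt _ a (h c) c' a0; rewrite lt fc'.
  by have := e ltac:(lra) => + /(_ ltac:(lra)); lra.
have left x : 0 <= x <= c -> h (left_branch b x) = left_branch a (h x).
  move=> /andP[x0]; rewrite le_eqVlt => /orP[/eqP->|xc].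
    by rewrite fc h1 hcc' fc'.
  have xc' : 0 <= x < c by lra.
  rewrite -(manneville_pomeau_left b0 fc xc') hcE; last lra.
  rewrite (manneville_pomeau_left a0 fc')// -hcc' mono//; last lra.
  by rewrite andbT; case/andP: (hm' x ltac:(lra)).
(* At x = 1 the map itself takes the value 0, so the identity for the continued branch comes from h
   1 = 1 instead. *)
have right x : c <= x <= 1 -> h (left_branch b x - 1) = left_branch a (h x) - 1.
  move=> /andP[cx]; rewrite le_eqVlt => /orP[/eqP->|x1].
    by rewrite h1 !left_branch1 (_ : 2 - 1 = 1) ?h1//; lra.
  have xc' : c <= x < 1 by lra.
  have c0 : 0 < c by lra.
  rewrite -(manneville_pomeau_right b0 c0 fc xc') hcE; last lra.
  rewrite (manneville_pomeau_right a0 _ fc')//; first lra.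
  rewrite -hcc' -[X in _ < X]h1 mono//; last lra.
  rewrite andbT; move: cx; rewrite le_eqVlt => /orP[/eqP->//|cx].
  by rewrite ltW// mono//; lra.
exists c; first by split.
have gm' z : 0 <= z <= 1 -> 0 <= g z <= 1.
  by move=> ?; have := gm z; rewrite /= !in_itv/= => /(_ _); apply.
have gh' x : 0 <= x <= 1 -> g (h x) = x by move=> ?; apply: gh; rewrite in_itv.
have hg' x : 0 <= x <= 1 -> h (g x) = x by move=> ?; apply: hg; rewrite in_itv.
have gmono x y : 0 <= x -> x < y -> y <= 1 -> g x < g y.
  move=> x0 xy y1; rewrite ltNge; apply/negP; rewrite le_eqVlt.
  have [gx gy] : 0 <= g x <= 1 /\ 0 <= g y <= 1 by split; apply: gm'; lra.
  move=> /orP[/eqP e|lt].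
    by have := hg' x ltac:(lra); rewrite -e hg'; lra.
  by have := mono _ _ _ lt; rewrite !hg'; lra.
have g0 : g 0 = 0 by rewrite -{1}h0 gh'; lra.
have g1 : g 1 = 1 by rewrite -{1}h1 gh'; lra.
exists g => //; split => //.
- by rewrite hcc'.
- move=> z /andP[z0 zc]; have z01 : 0 <= z <= 1 by lra.
  have gz := gm' z z01.
  have gzc : 0 <= g z <= c.
    rewrite -(gh' c ltac:(lra)); move: zc; rewrite le_eqVlt => /orP[/eqP->|zc].
      by rewrite lexx andbT gh'; lra.
    by have := gmono z (h c) z0 zc ltac:(lra); lra.
  have := left (g z) gzc; rewrite hg'// => <-; rewrite gh'//.
  rewrite addr_ge0 ?powR_ge0//=; last lra.
  by rewrite -[leRHS]fc left_branch_mono.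
move=> z /andP[zc z1]; have z01 : 0 <= z <= 1 by lra.
have gz := gm' z z01.
have gzc : c <= g z <= 1.
  rewrite -(gh' c ltac:(lra)); move: zc; rewrite le_eqVlt => /orP[/eqP<-|zc].
    by rewrite lexx/= gh'; lra.
  by have := gmono (h c) z ltac:(lra) zc z1; lra.
have := right (g z) gzc; rewrite hg'// => <-; rewrite gh'//.
have f1 : left_branch b c <= left_branch b (g z) by apply: left_branch_mono => //; lra.
have f2 : left_branch b (g z) <= left_branch b 1 by apply: left_branch_mono => //; lra.
by move: f1 f2; rewrite left_branch1 fc; lra.
Qed.
End Branches.

(** * Power lower bound and Hoelder estimate from the branch equations *)

Section Hoelder.
Variable R : realType.
Implicit Types (a b c x y z k s : R) (h : R -> R).

Lemma powR_le1 x s : 0 <= x <= 1 -> 0 <= s -> x `^ s <= 1.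
Proof.
move=> /andP[x0 x1] s0; have := @ge0_ler_powR _ s s0 x 1.
by rewrite !nnegrE powR1; apply.
Qed.

Lemma branch_conj_le b a h c x y : branch_conj b a h c ->
  0 <= x -> x <= y -> y <= 1 -> h x <= h y.
Proof.
move=> H x0; rewrite le_eqVlt => /orP[/eqP->//|xy] y1.
by rewrite ltW// (bc_homo H).
Qed.

Lemma branch_conj_range b a h c x : branch_conj b a h c ->
  0 <= x <= 1 -> 0 <= h x <= 1.
Proof.
move=> H /andP[x0 x1]; rewrite -{1}(bc_0 H) -(bc_1 H).
by rewrite !(branch_conj_le H).
Qed.

Lemma left_branch_range b c x : 0 < b -> 0 < c -> left_branch b c = 1 ->
  0 <= x <= c -> 0 <= left_branch b x <= 1.
Proof.
move=> b0 c0 fc /andP[x0 xc]; rewrite addr_ge0 ?powR_ge0//=.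
by rewrite -fc left_branch_mono ?x0.
Qed.

Lemma right_branch_range b c x : 0 < b -> 0 < c -> left_branch b c = 1 ->
  c <= x <= 1 -> 0 <= left_branch b x - 1 <= 1.
Proof.
move=> b0 c0 fc /andP[cx x1].
have := @left_branch_mono _ b x c b0; have := @left_branch_mono _ b 1 x b0.
rewrite fc left_branch1 cx x1 (ltW c0) => /(_ ltac:(lra)) + /(_ isT).
lra.
Qed.

(** The two smallness conditions serve one branch each: (1 - k^a) / 2 the left one, (1 - k) / 3 the
    right one. *)
Lemma branch_conj_ge b a h c k x : 0 < b -> 0 < a -> branch_conj b a h c ->
  0 < k < 1 -> `|b / a - 1| <= (1 - k) / 3 -> `|b / a - 1| <= (1 - k `^ a) / 2 ->
  0 <= x <= 1 -> k * x `^ (b / a) <= h x.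
Proof.
move=> b0 a0 H /andP[k0 k1]; set B := b / a => hB1 hB2 x01.
have B0 : 0 < B by rewrite divr_gt0.
have ka : 0 <= k `^ a <= 1.
  by rewrite powR_ge0 powR_le1 ?(ltW a0)// (ltW k0) ltW.
have /andP[c0 c1] := bc_c H.
(* The exponent b / a is chosen so that (k z^(b/a))^a = k^a z^b, the order of growth of the other
   map. *)
have psiE z : 0 <= z -> left_branch a (k * z `^ B) = k * z `^ B * (1 + k `^ a * z `^ b).
  move=> z0; have kz : 0 <= k * z `^ B by rewrite mulr_ge0 ?powR_ge0// ltW.
  rewrite /left_branch powR1D// powRM ?powR_ge0 ?(ltW k0)// -powRrM /B divfK ?gt_eqF//.
  ring.
rewrite leNgt; apply/negP => lt.
pose q z := k * z `^ B - h z.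
have d0 : 0 < q x by rewrite subr_gt0.
suff : q x < q x by rewrite ltxx.
(* A gap q z >= q x forces k z^B >= q x because h z >= 0, whence the expansion rate 1 + (q x)^a. *)
apply: (@no_expansion _ R (fun z => 0 <= z <= 1 /\ 0 < q z) q (q x `^ a)) => //.
- by rewrite powR_gt0.
- move=> z [z01 _]; have := powR_le1 z01 (ltW B0).
  have := branch_conj_range H z01; have := powR_ge0 z B; rewrite /q; nra.
move=> z [z01 qz0] dz.
have /andP[z0 z1] := z01; have hz := branch_conj_range H z01.
have grow : (1 + q x `^ a) * q z <= left_branch a (k * z `^ B) - left_branch a (h z).
  apply: (@le_trans _ _ ((1 + (k * z `^ B) `^ a) * q z)).
    rewrite ler_pM2r// lerD2l; apply: ge0_ler_powR; rewrite ?nnegrE ?(ltW a0) ?(ltW d0)//.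
      by rewrite mulr_ge0 ?powR_ge0// ltW.
    by move: dz; rewrite /q; lra.
  by apply: left_branch_expand => //; move: qz0; rewrite /q; lra.
have growP u : (1 + q x `^ a) * q z <= u -> 0 < u.
  by apply: lt_le_trans; rewrite mulr_gt0// ltr_wpDr ?powR_ge0.
have [zc|/ltW cz] := leP z c.
  have zc' : 0 <= z <= c by rewrite z0.
  have le : (1 + q x `^ a) * q z <= q (left_branch b z).
    apply: (le_trans grow); rewrite /q (bc_left H zc') lerD2r (psiE _ z0).
    have -> : left_branch b z = z * (1 + z `^ b).
      by rewrite /left_branch powR1D//; ring.
    rewrite powRM ?addr_ge0 ?powR_ge0// mulrA ler_wpM2l ?mulr_ge0 ?powR_ge0 ?(ltW k0)//.
    (* Here sigma = k^a and t = z^b. *)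
    by apply: powR_1D_ge => //; rewrite powR_ge0 powR_le1// ltW.
  exists (left_branch b z) => //; split; last exact: growP le.
  exact: left_branch_range (bc_fc H) _.
have zc' : c <= z <= 1 by rewrite cz.
have y01 := right_branch_range b0 c0 (bc_fc H) zc'.
have le : (1 + q x `^ a) * q z <= q (left_branch b z - 1).
  apply: (le_trans grow); rewrite /q (bc_right H zc').
  (* Replacing the powers by their bases costs at most 3 eta in total; subtracting 1 rather than k
     leaves room 1 - k >= 3 eta. *)
  suff : left_branch a (k * z `^ B) - 1 <= k * (left_branch b z - 1) `^ B by lra.
  rewrite (psiE _ z0).
  have w0 := powR_ge0 z b; have w1 := powR_le1 z01 (ltW b0).
  have := powR_sub_id z01 B0; have := powR_sub_id y01 B0.
  have yE : left_branch b z = z + z * z `^ b by rewrite /left_branch powR1D.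
  rewrite !ler_norml.
  set Y := _ `^ B; set X := z `^ B; set w := z `^ b in w0 w1 yE *.
  set eta := `|_| in hB1 *; move=> /andP[hY _] /andP[_ hX].
  have X0 : 0 <= X := powR_ge0 _ _.
  have e0 : 0 <= eta := normr_ge0 _.
  have h1 : X * (1 + k `^ a * w) <= X * (1 + w) 
    by rewrite ler_wpM2l// lerD2l ler_piMl//; case/andP: ka.
  have h2 : X * (1 + w) <= (z + eta) * (1 + w) by rewrite ler_wpM2r//; lra.
  have h3 : (z + eta) * (1 + w) <= z + z * w + 2 * eta.
    have : eta * w <= eta by rewrite ler_piMr.
    lra.
  have h4 : X * (1 + k `^ a * w) <= Y + 1 + 3 * eta by lra.
  have : k * (X * (1 + k `^ a * w)) <= k * (Y + 1 + 3 * eta) by rewrite ler_pM2l.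
  nra.
exists (left_branch b z - 1) => //; split => //; exact: growP le.
Qed.

(** The bound is proved in turn for pairs far apart in ratio, for pairs ending at 1, for pairs
    having c as an endpoint, and for all pairs. *)
Lemma branch_conj_hoelder b a h c s kap C0 : 0 < b -> 0 < a ->
  branch_conj b a h c -> 0 < s -> 1 < kap -> 0 <= C0 ->
  (forall x, 0 <= x <= 1 -> h x <= C0 * x `^ s) ->
  (forall x y, 0 <= x -> x <= y -> y <= 1 -> y <= kap * x ->
    (1 + (1 + b) * y `^ b) `^ s <= 1 + (1 + a) * h x `^ a) ->
  exists C, forall x y, 0 <= x -> x <= y -> y <= 1 -> h y - h x <= C * (y - x) `^ s.
Proof.
move=> b0 a0 H s0 kap1 C00 hC0 hD.
have /andP[c0 c1] := bc_c H.
have fc := bc_fc H.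
have powRmono x y : 0 <= x -> x <= y -> x `^ s <= y `^ s.
  by move=> x0 xy; apply: ge0_ler_powR; rewrite ?nnegrE ?(ltW s0)//; apply: le_trans xy.
have range := branch_conj_range H.
pose hold K x y := h y - h x <= K * (y - x) `^ s.
(* If y > kap x, then y <= kap / (kap - 1) (y - x), so the bound at 0 gives the estimate with this
   constant. *)
pose C1 := C0 * (kap / (kap - 1)) `^ s.
have C10 : 0 <= C1 by rewrite mulr_ge0 ?powR_ge0.
have holdW K L x y : K <= L -> hold K x y -> hold L x y.
  by move=> KL /le_trans; apply; rewrite ler_wpM2r ?powR_ge0.
have far x y : 0 <= x -> x < y -> y <= 1 -> kap * x < y -> hold C1 x y.
  move=> x0 xy y1 kxy.
  have := hC0 y ltac:(lra); have := range x ltac:(lra).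
  have y0 : 0 <= y by lra.
  have le : y <= kap / (kap - 1) * (y - x).
    by rewrite mulrAC ler_pdivlMr ?subr_gt0//; nra.
  have := powRmono _ _ y0 le.
  rewrite powRM; [|by rewrite divr_ge0//; lra|lra].
  rewrite /hold /C1 => h1 h2 h3.
  have := ler_wpM2l C00 h1; lra.
(* By convexity the lift stretches h y - h x at least by its derivative at h x, and y - x at most by
   its derivative at y; [hD] compares the two. *)
have pull K x y : 0 <= K -> 0 <= x -> x < y -> y <= 1 -> y <= kap * x ->
    left_branch a (h y) - left_branch a (h x) <=
      K * (left_branch b y - left_branch b x) `^ s -> hold K x y.
  move=> K0 x0 xy y1 ykx hyp.
  have D := hD x y x0 (ltW xy) y1 ykx.
  have hx := range x ltac:(lra); have hy := range y ltac:(lra).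
  have u0 : 0 <= y - x by lra.
  set m := 1 + (1 + a) * _ in D.
  have m0 : 0 < m by rewrite ltr_wpDr// mulr_ge0 ?powR_ge0//; lra.
  rewrite /hold -(ler_pM2l m0).
  have ge := @left_branch_ge _ a (h y) (h x) a0 ltac:(lra) ltac:(lra).
  apply: (le_trans ge); apply: (le_trans hyp).
  have fu : left_branch b x <= left_branch b y.
    by apply: left_branch_mono; rewrite ?x0 ?ltW.
  have h1 : (left_branch b y - left_branch b x) `^ s <= m * (y - x) `^ s.
    apply: (@le_trans _ _ (((1 + (1 + b) * y `^ b) * (y - x)) `^ s)).
      by apply: powRmono; [lra|apply: left_branch_le => //; lra].
    rewrite powRM//; first by rewrite ler_wpM2r ?powR_ge0.
    by rewrite addr_ge0// mulr_ge0 ?powR_ge0//; lra.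
  by rewrite mulrCA ler_wpM2l.
have hold0 K : 0 <= K -> hold K 0 0 by move=> K0; rewrite /hold !subrr mulr_ge0 ?powR_ge0.
have image_left K x y : 0 <= K -> 0 <= x -> x < y -> y <= c -> y <= kap * x ->
    hold K (left_branch b x) (left_branch b y) -> hold K x y.
  move=> K0 x0 xy yc ykx; rewrite {1}/hold !(bc_left H); [|lra|lra].
  by apply: pull => //; lra.
have image_right K x y : 0 <= K -> c <= x -> x < y -> y <= 1 -> y <= kap * x ->
    hold K (left_branch b x - 1) (left_branch b y - 1) -> hold K x y.
  move=> K0 cx xy y1 ykx; rewrite {1}/hold !(bc_right H); [|lra|lra].
  move=> hyp; apply: pull => //; first lra.
  by move: hyp; rewrite !opprB !addrA !subrK.
(* [Q] is an invariant of pairs: unless the bound already holds, the pair lies in one branch and its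
   image is again in [Q]. *)
pose step (Q : R -> R -> Prop) K x y := hold K x y \/
  (y <= c /\ Q (left_branch b x) (left_branch b y)) \/
  (c <= x /\ Q (left_branch b x - 1) (left_branch b y - 1)).
(* A pair violating the bound has an image pair violating it too, whose gap is
   larger by the factor 1 + (y - x)^b. *)
have escape (Q : R -> R -> Prop) K : C1 <= K ->
    (forall x y, 0 <= x -> x < y -> y <= 1 -> Q x y -> step Q K x y) ->
    forall x y, 0 <= x -> x < y -> y <= 1 -> Q x y -> hold K x y.
  move=> CK hQ x y x0 xy y1 Qxy; have K0 := le_trans C10 CK.
  apply: contrapT => nh.
  pose P p := [/\ 0 <= p.1, p.1 < p.2, p.2 <= 1, Q p.1 p.2 & ~ hold K p.1 p.2].
  have d0 : 0 < y - x by lra.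
  suff : y - x < y - x by rewrite ltxx.
  apply: (@no_expansion _ (R * R)%type P (fun p => p.2 - p.1) ((y - x) `^ b)
    _ _ d0 _ _ (x, y)).
  - by rewrite powR_gt0.
  - by move=> [u v] [/= *]; lra.
  - move=> [u v] [/= u0 uv v1 Quv nuv] duv.
    have vku : v <= kap * u.
      by rewrite leNgt; apply/negP => /(far _ _ u0 uv v1)/(holdW _ _ _ _ CK).
    have grow : (1 + (y - x) `^ b) * (v - u) <= left_branch b v - left_branch b u.
      apply: (@le_trans _ _ ((1 + v `^ b) * (v - u))).
        rewrite ler_wpM2r ?subr_ge0 ?(ltW uv)// lerD2l.
        by apply: ge0_ler_powR; rewrite ?nnegrE ?(ltW b0)//; lra.
      by apply: left_branch_expand => //; lra.
    have lt : left_branch b u < left_branch b v by apply: left_branch_lt; rewrite ?u0.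
    have [//|[[vc Q']|[cu Q']]] := hQ u v u0 uv v1 Quv.
      exists (left_branch b u, left_branch b v) => //.
      have := @left_branch_range b c u b0 c0 fc ltac:(lra).
      have := @left_branch_range b c v b0 c0 fc ltac:(lra).
      move=> /andP[_ ?] /andP[? _]; split => //= hh.
      by apply: nuv; exact: image_left.
    exists (left_branch b u - 1, left_branch b v - 1) => /=; last lra.
    have := @right_branch_range b c u b0 c0 fc ltac:(lra).
    have := @right_branch_range b c v b0 c0 fc ltac:(lra).
    move=> /andP[_ ?] /andP[? _]; split => //=; first lra.
    by move=> hh; apply: nuv; exact: image_right.
  - by split.
(* The second term handles pairs (x, 1) with x < c: their length is at least 1 - c, while h
   increases by at most 1. *)
pose C := C1 + ((1 - c) `^ s)^-1.
have ic0 : 0 < (1 - c) `^ s by rewrite powR_gt0; lra.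
have C1C : C1 <= C by rewrite lerDl invr_ge0 ltW.
have CC : 0 <= C := le_trans C10 C1C.
(* The right branch fixes 1, so having right endpoint 1 is an invariant until x falls left of c. *)
have to1 x : 0 <= x -> x <= 1 -> hold C x 1.
  move=> x0; rewrite le_eqVlt => /orP[/eqP->|x1].
    by rewrite /hold !subrr mulr_ge0 ?powR_ge0.
  apply: (@escape (fun _ y => y = 1) C) => // {x1 x0 x} x y x0 xy _ ->.
  have [cx|xc] := leP c x; first by right; right; rewrite left_branch1; split => //; lra.
  left; have := range x ltac:(lra); rewrite /hold (bc_1 H) => /andP[hx _].
  apply: (@le_trans _ _ 1); first lra.
  have := powRmono (1 - c) (1 - x) ltac:(lra) ltac:(lra).
  move=> /(ler_wpM2l CC); apply: le_trans.
  by rewrite /C mulrDl mulVf ?gt_eqF// lerDr mulr_ge0 ?powR_ge0.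
(* One application of the left branch turns the endpoint c into 1. *)
have toc x : 0 <= x -> x <= c -> hold C x c.
  move=> x0; rewrite le_eqVlt => /orP[/eqP->|xc].
    by rewrite /hold !subrr mulr_ge0 ?powR_ge0.
  have [ck|kc] := leP c (kap * x); last by apply: (holdW C1) => //; apply: far; lra.
  apply: image_left => //; rewrite fc.
  have /andP[? ?] := @left_branch_range b c x b0 c0 fc ltac:(lra).
  exact: to1.
(* One application of the right branch turns the endpoint c into 0, and every pair (0, y) with y > 0
   is far. *)
have fromc y : c <= y -> y <= 1 -> hold C c y.
  rewrite le_eqVlt => /orP[/eqP->|cy] y1.
    by rewrite /hold !subrr mulr_ge0 ?powR_ge0.
  have [yk|ky] := leP y (kap * c); last by apply: (holdW C1) => //; apply: far; lra.
  apply: image_right => //; rewrite fc subrr.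
  have /andP[] := @right_branch_range b c y b0 c0 fc ltac:(lra).
  rewrite le_eqVlt => /orP[/eqP<- _|? ?]; first exact: hold0.
  by apply: (holdW C1) => //; apply: far; lra.
exists (C + C) => x y x0; rewrite le_eqVlt => /orP[/eqP->|xy] y1.
  by rewrite !subrr mulr_ge0 ?powR_ge0// addr_ge0.
apply: (@escape (fun _ _ => True)) => //; first lra.
move=> {x0 xy y1 x y} x y x0 xy y1 _.
have [yc|cy] := leP y c; first by right; left.
have [cx|xc] := leP c x; first by right; right.
left; have := toc x x0 (ltW xc); have := fromc y (ltW cy) y1; rewrite /hold (mulrDl C C).
have := powRmono (c - x) (y - x) ltac:(lra) ltac:(lra).
have := powRmono (y - c) (y - x) ltac:(lra) ltac:(lra).
move=> /(ler_wpM2l CC) + /(ler_wpM2l CC); lra.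
Qed.
End Hoelder.

(** * Choice of the constants for beta close to alpha *)

Section ConjugacyHoelder.
Variable R : realType.
Implicit Types (a b c x y z k s : R) (h : R -> R).

Lemma branch_conj_inv_le b a h g c s : 0 < b -> 0 < a -> 0 < s ->
  branch_conj b a h c -> branch_conj a b g (h c) ->
  (forall x, 0 <= x <= 1 -> g (h x) = x) ->
  s <= b / a -> `|a / b - 1| <= 6^-1 ->
  exists2 C, 0 <= C & forall x, 0 <= x <= 1 -> h x <= C * x `^ s.
Proof.
move=> b0 a0 s0 H G gh sb hab.
have ib0 : 0 < b^-1 by rewrite invr_gt0.
have half1 t : 1 <= t -> (2^-1 : R) `^ t <= 2^-1 by move=> t1; apply: ge1r_powR; lra.
(* The exponent makes both k and k^b at most 1/2, so 1/6 satisfies both smallness conditions of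
   [branch_conj_ge] for g. *)
pose k := (2^-1 : R) `^ (1 + b^-1).
have k0 : 0 < k by rewrite powR_gt0.
have k1 : k <= 2^-1 by apply: half1; lra.
have kb : k `^ b <= 2^-1.
  by rewrite /k -powRrM mulrDl mul1r mulVf ?gt_eqF//; apply: half1; lra.
exists (k^-1 `^ (b / a)) => [|x x01]; first exact: powR_ge0.
have hx := branch_conj_range H x01; have /andP[x0 x1] := x01.
have := @branch_conj_ge _ a b g (h c) k (h x) a0 b0 G ltac:(lra) ltac:(lra) ltac:(lra) hx.
rewrite gh// => le.
have le2 : h x `^ (a / b) <= k^-1 * x by rewrite -(ler_pM2l k0) mulrA divff ?mul1r ?gt_eqF.
have ba0 : 0 < b / a by rewrite divr_gt0.
have -> : h x = (h x `^ (a / b)) `^ (b / a).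
  rewrite -powRrM (_ : a / b * (b / a) = 1) ?powRr1//; first by case/andP: hx.
  by field; rewrite !gt_eqF.
apply: (@le_trans _ _ ((k^-1 * x) `^ (b / a))).
  by apply: ge0_ler_powR; rewrite ?nnegrE ?powR_ge0 ?(ltW ba0)// mulr_ge0// invr_ge0 ltW.
rewrite powRM// ?invr_ge0 ?(ltW k0)// ler_wpM2l ?powR_ge0//.
move: x0; rewrite le_eqVlt => /orP[/eqP<-|x0]; first by rewrite !powR0// gt_eqF.
by apply: ger_powR => //; rewrite x0.
Qed.

Lemma conjugacy_hoelder b a h s : 0 < b -> 0 < a -> 0 < s < 1 ->
  is_conjugacy01 (manneville_pomeau b) (manneville_pomeau a) h ->
  `|b / a - 1| <= (1 - ((1 + s) / 2) `^ a^-1) / 3 ->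
  `|b / a - 1| <= (1 - s) / 4 -> `|b / a - 1| <= 7^-1 ->
  exists C, forall x y, 0 <= x -> x <= y -> y <= 1 -> h y - h x <= C * (y - x) `^ s.
Proof.
move=> b0 a0 /andP[s0 s1] hc B1 B2 B3.
have [c H [g G gh]] := conjugacy_branch_conj b0 a0 hc.
have B0 : 0 < b / a by rewrite divr_gt0.
have iB : a / b = (b / a)^-1 by rewrite invf_div.
have hB : s <= b / a by move: B2; rewrite ler_norml; lra.
have iB0 : 0 < a / b by rewrite divr_gt0.
have BiB : b / a * (a / b) = 1 by rewrite iB divff// gt_eqF.
(* From b / a >= 6/7, the reciprocal deviates from 1 by at most (1/7) (7/6). *)
have hab : `|a / b - 1| <= 6^-1.
  move: B3; rewrite !ler_norml => /andP[? ?]; apply/andP; split; nra.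
have [C0 C00 hC0] := branch_conj_inv_le b0 a0 s0 H G gh hB hab.
have [k [k0 k1 ka hk]] : exists k, [/\ 0 < k, k < 1, k `^ a = (1 + s) / 2 &
    forall x, 0 <= x <= 1 -> k * x `^ (b / a) <= h x].
  exists (((1 + s) / 2) `^ a^-1).
  have k0 : 0 < ((1 + s) / 2) `^ a^-1 by rewrite powR_gt0; lra.
  have k1 : ((1 + s) / 2) `^ a^-1 < 1.
    rewrite [ltRHS](_ : 1 = 1 `^ a^-1); last by rewrite powR1.
    by apply: gt0_ltr_powR; rewrite ?nnegrE ?invr_gt0//; lra.
  have ka : (((1 + s) / 2) `^ a^-1) `^ a = (1 + s) / 2.
    by rewrite -powRrM mulVf ?gt_eqF// powRr1//; lra.
  split=> // x; apply: (branch_conj_ge b0 a0 H); rewrite ?k0 ?ka//.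
  by apply: (le_trans B2); lra.
have sb0 : 0 < s * (1 + b) by rewrite mulr_gt0//; lra.
(* This [kap] is the largest ratio the comparison of derivatives tolerates; it exceeds 1 because s <
   (1 + s) / 2 leaves room for the small b - a. *)
have [kap kap1 kapb] : exists2 kap, 1 < kap &
    s * (1 + b) * kap `^ b = (1 + a) * ((1 + s) / 2).
  pose rho := (1 + a) * ((1 + s) / 2) / (s * (1 + b)).
  have rho1 : 1 < rho.
    rewrite ltr_pdivlMr// mul1r.
    have : b - a <= a * ((1 - s) / 4).
      have -> : b - a = a * (b / a - 1) by field; rewrite gt_eqF.
      by rewrite ler_pM2l//; apply: le_trans B2; exact: ler_norm.
    move=> hba; have : s * (b - a) <= s * (a * ((1 - s) / 4)) by rewrite ler_pM2l.
    have w0 : 0 < a * (1 - s) by rewrite mulr_gt0// subr_gt0.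
    have : s * (a * (1 - s)) <= a * (1 - s) by rewrite ler_piMl// ltW.
    lra.
  exists (rho `^ b^-1); last first.
    rewrite -powRrM mulVf ?gt_eqF// powRr1; last lra.
    by rewrite mulrC divfK// gt_eqF.
  rewrite [ltLHS](_ : 1 = 1 `^ b^-1); last by rewrite powR1.
  by apply: gt0_ltr_powR; rewrite ?nnegrE ?invr_gt0//; lra.
apply: (@branch_conj_hoelder _ b a h c s kap C0) => // x y x0 xy y1 ykx.
have pb := powR_ge0 y b.
(* Bernoulli's inequality turns the exponent s into a factor s, to be compared with the factor k^a =
   (1 + s) / 2. *)
have h1 : (1 + (1 + b) * y `^ b) `^ s <= 1 + s * ((1 + b) * y `^ b).
  have nn : 0 <= (1 + b) * y `^ b by apply: mulr_ge0 => //; lra.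
  have := @powR_le_tangent1 _ s (1 + (1 + b) * y `^ b) ltac:(lra) ltac:(lra).
  lra.
have h2 : y `^ b <= kap `^ b * x `^ b.
  rewrite -powRM//; last lra.
  by apply: ge0_ler_powR; rewrite ?nnegrE ?(ltW b0)//; lra.
have h3 : (1 + s) / 2 * x `^ b <= h x `^ a.
  have -> : (1 + s) / 2 * x `^ b = (k * x `^ (b / a)) `^ a.
    by rewrite powRM ?powR_ge0 ?(ltW k0)// ka -powRrM divfK// gt_eqF.
  apply: ge0_ler_powR; rewrite ?nnegrE ?(ltW a0)//.
  - by rewrite mulr_ge0 ?powR_ge0// ltW.
  - by case/andP: (branch_conj_range H (x := x) ltac:(lra)).
  - by apply: hk; lra.
apply: (le_trans h1); rewrite lerD2l mulrA.
apply: (@le_trans _ _ (s * (1 + b) * (kap `^ b * x `^ b))); first by rewrite ler_pM2l.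
by rewrite mulrA kapb -mulrA ler_pM2l//; lra.
Qed.
End ConjugacyHoelder.

(** * Images of points with zero derivative are Lebesgue null *)

Section NullImages.
Variable R : realType.
Implicit Types (h : R -> R) (x y t C : R) (A : set R).
Local Notation mu := (@lebesgue_measure R).

Lemma lebesgue_measure_cc (c r : R) : 0 <= r -> mu `[c - r, c + r]%classic = (r *+ 2)%:E.
Proof.
move=> r0; rewrite lebesgue_measure_itv/= lte_fin.
case: ltP => h; first by rewrite -EFinB; congr EFin; ring.
by congr EFin; lra.
Qed.

(** The point x = 1 has index n + 1, hence n + 2 cells. *)
Lemma grid_cell n x : 0 <= x <= 1 ->
  exists2 i : nat, (i < n.+2)%N & i%:R <= x * n.+1%:R < i.+1%:R.
Proof.
move=> /andP[x0 x1]; have xn : 0 <= x * n.+1%:R by rewrite mulr_ge0.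
exists (Num.Def.truncn (x * n.+1%:R)); last exact: truncn_itv.
rewrite -(ltr_nat R); have /andP[/le_lt_trans + _] := truncn_itv xn; apply.
apply: (@le_lt_trans _ _ n.+1%:R); first by rewrite ler_piMl.
by rewrite ltr_nat.
Qed.

(** W is the union over n of the intersections of V m for m >= n; these increase with n and have
    measure at most M. *)
Lemma measure_liminf_le (V : (set R)^nat) (M : \bar R) :
  (forall n, measurable (V n)) -> (forall n, mu (V n) <= M)%E ->
  exists W : set R, [/\ measurable W, (mu W <= M)%E &
    forall x n, (forall m, (n <= m)%N -> V m x) -> W x].
Proof.
move=> mV VM; pose W n := \bigcap_(m in [set m | (n <= m)%N]) V m.
have mW n : measurable (W n).
  by apply: bigcap_measurable => //; exists n => /=.
have mW' : measurable (\bigcup_n W n) by exact: bigcupT_measurable.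
exists (\bigcup_n W n); split => // [|x n H]; last by exists n.
have ndW : nondecreasing_seq W.
  move=> m n mn; apply/subsetPset => x H k /= nk; apply: H => /=.
  exact: leq_trans nk.
have cvW := nondecreasing_cvg_mu (mu := mu) mW mW' ndW.
rewrite -(cvg_lim _ cvW)//; apply: lime_le; first by apply/cvg_ex; eexists; exact: cvW.
apply: nearW => n /=; apply: le_trans (VM n); 
apply: le_measure; rewrite ?inE; [exact: mW|exact: mV|].
by move=> x Wx; exact: (Wx n (leqnn n)).
Qed.

(* The images h(B n) increase to a superset of the set to be covered, but need not
   be measurable; continuity from below is applied to the liminf of their covers. *)
Lemma zero_deriv_image_null h e : 0 < e -> exists W : set R,
  [/\ measurable W, (mu W <= e%:E)%E &
    forall x, 0 <= x <= 1 -> has_deriv01 h x 0 -> W (h x)].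
Proof.
(* The n + 2 intervals of length 2 d / (n + 1) then have total length at most e. *)
move=> e0; pose d := e / 4; have d0 : 0 < d by rewrite divr_gt0.
pose B n := [set x | 0 <= x <= 1 /\ forall y, 0 <= y <= 1 ->
   `|y - x| <= n.+1%:R^-1 -> `|h y - h x| <= d * `|y - x|].
pose cell (n i : nat) x := i%:R <= x * n.+1%:R < i.+1%:R.
(* The centre is the image of any point of [B n] in the cell, and 0 by default if there is none. *)
have /choice[c hc] (p : nat * nat) : exists c, forall x, B p.1 x -> cell p.1 p.2 x ->
    `|h x - c| <= d / p.1.+1%:R.
  case: p => n i /=; have [[p [Bp cp]]|no] := pselect (exists p, B n p /\ cell n i p).
    exists (h p) => x [x01 _] cx.
    have n0 : 0 < n.+1%:R :> R by [].
    have le : `|x - p| <= n.+1%:R^-1.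
      rewrite -[leRHS]mul1r ler_pdivlMr// -[X in _ * X]ger0_norm// -normrM mulrBl.
      move: cx cp; rewrite /cell -!natr1 ler_norml; lra.
    apply: le_trans (Bp.2 x x01 le) _.
    by rewrite ler_pM2l.
  by exists 0 => x Bx cx; case: no; exists x.
pose J n i := `[c (n, i) - d / n.+1%:R, c (n, i) + d / n.+1%:R]%classic.
pose V n := \big[setU/set0]_(i < n.+2) J n i.
have mJ n i : measurable (J n i) by exact: measurable_itv.
have [||W [mW We VW]] := @measure_liminf_le V e%:E.
- by move=> n; apply: bigsetU_measurable.
- move=> n; apply: (le_trans (Boole_inequality mu (fun i _ => mJ n i))).
  have muJ i : mu (J n i) = (d / n.+1%:R *+ 2)%:E.
    by rewrite /J lebesgue_measure_cc// divr_ge0// ltW.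
  rewrite (eq_bigr (fun=> (d / n.+1%:R *+ 2)%:E)) => [|i _]; last exact: muJ.
  rewrite sumEFin lee_fin sumr_const card_ord.
  have N1 : 1 <= n.+1%:R :> R by rewrite ler1n.
  rewrite -[X in X <= _](mulr_natr _ n.+2) -(mulr_natr _ 2) -(natr1 n.+1) /d.
  move: (n.+1%:R : R) N1 => N N1.
  have -> : e / 4 / N * 2 * (N + 1) = e / 2 * (N + 1) / N by field; rewrite gt_eqF//; lra.
  by rewrite ler_pdivrMr; [nra|lra].
exists W; split => // x x01 hx.
have : \forall y \near within `[0, 1] x^', `|(h y - h x) / (y - x)| < d.
  move/cvgrPdist_lt : hx => /(_ _ d0); apply: filterS => y.
  by rewrite sub0r normrN.
rewrite /within/= => -[r /= r0 hr].
(* For every m >= n the scale 1 / (m + 1) is below r, so x lies in all later [B m]. *)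
have [n nr] : exists n : nat, n.+1%:R^-1 < r.
  exists (Num.Def.truncn r^-1); rewrite invf_plt ?posrE//.
  exact: truncnS_gt.
apply: (VW _ n) => m nm.
have Bx : B m x.
  split => // y y01 yx; have [->|yNx] := eqVneq y x; first by rewrite !subrr !normr0 mulr0.
  have := hr y; rewrite /ball/= => /(_ _)/(_ yNx).
  rewrite normrM normfV ltr_pdivrMr ?normr_gt0 ?subr_eq0//.
  move=> H; apply/ltW/H; last by rewrite in_itv.
  rewrite distrC; apply: le_lt_trans yx _; apply: le_lt_trans nr.
  by rewrite lef_pV2 ?posrE// ler_nat.
have [i im ci] := grid_cell m x01.
rewrite /V -bigcup_mkord; exists i => //.
have := hc (m, i) x Bx ci; rewrite /J/= in_itv/= ler_norml.
by move: (d / _) (c _) => D z; lra.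
Qed.
End NullImages.

(** * Hausdorff dimension: lower bound from Hoelder maps, upper bound 1 *)

Section Dimension.
Variable R : realType.
Implicit Types (h : R -> R) (x y t C s : R) (A U : set R).
Local Notation mu := (@lebesgue_measure R).

Lemma diam_ge U x y : U x -> U y -> (`|x - y|%:E <= diam U)%E.
Proof. by move=> Ux Uy; apply: ereal_sup_ubound; exists (x, y). Qed.

Lemma diam_le U (d : \bar R) :
  (forall x y, U x -> U y -> (`|x - y|%:E <= d)%E) -> (diam U <= d)%E.
Proof. by move=> H; apply: ge_ereal_sup => _ [[x y] [/= Ux Uy] <-]; exact: H. Qed.

Lemma hausdorff_gauge_ge0 s U : (0 <= hausdorff_gauge s U)%E.
Proof. by rewrite /hausdorff_gauge; case: ifP => // _; exact: poweR_ge0. Qed.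

Lemma hausdorff_gauge_fin t U (d : R) : 0 <= t -> (diam U <= d%:E)%E ->
  exists g : R, [/\ 0 <= g, hausdorff_gauge t U = g%:E &
    forall x y, U x -> U y -> `|x - y| `^ t <= g].
Proof.
move=> t0; rewrite /hausdorff_gauge; case: ifPn => [/eqP -> _|/set0P[x Ux]].
  by exists 0.
have := diam_ge Ux Ux; rewrite subrr normr0.
case E : (diam U) => [e| |]//= _ _; exists (e `^ t).
rewrite powR_ge0; split => // y z Uy Uz.
have := diam_ge Uy Uz; rewrite E lee_fin => yz.
by apply: ge0_ler_powR; rewrite ?nnegrE// (le_trans _ yz).
Qed.

Lemma hausdorff_content_ge0 s d A : (0 <= hausdorff_content s d A)%E.
Proof.
apply: le_ereal_inf_tmp => _ [U _ <-].
by apply: nneseries_ge0 => i _ _; exact: hausdorff_gauge_ge0.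
Qed.

(** A covering set of gauge g has its part of [A] mapped into an interval of length 2 C g, and the
    gauges can be made to have arbitrarily small sum. *)
Lemma hausdorff_null_hoelder_image h A t C e : 0 <= t -> 0 <= C ->
  A `<=` `[0, 1]%classic ->
  (forall x y, 0 <= x <= 1 -> 0 <= y <= 1 -> `|h x - h y| <= C * `|x - y| `^ t) ->
  hausdorff_measure t A = 0%E -> 0 < e ->
  exists W : set R, [/\ measurable W, (mu W <= e%:E)%E & forall x, A x -> W (h x)].
Proof.
move=> t0 C0 A01 hC A0 e0.
(* The summand 1 keeps the denominator positive when C = 0; the scale 1 is arbitrary. *)
have : (hausdorff_content t 1 A < (e / (2 * C + 1))%:E)%E.
  apply: (@le_lt_trans _ _ 0%E); last by rewrite lte_fin divr_gt0//; lra.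
  by rewrite -A0; apply: ereal_sup_ubound; exists 1 => //=.
move=> /ereal_inf_lt[_ [U [AU dU] <-] sumU].
have /choice[g hg] i := hausdorff_gauge_fin t0 (dU i).
have /choice[c hc] i : exists c, forall x, A x -> U i x -> `|h x - c| <= C * g i.
  have [[p [Ap Up]]|no] := pselect (exists p, A p /\ U i p); last first.
    by exists 0 => x Ax Ux; case: no; exists x.
  exists (h p) => x Ax Ux; have [_ _ gi] := hg i.
  have := A01 _ Ax; have := A01 _ Ap; rewrite /= !in_itv/= => p01 x01.
  by apply: le_trans (hC x p x01 p01) _; rewrite ler_wpM2l// gi.
have Cg i : 0 <= C * g i by case: (hg i) => *; rewrite mulr_ge0.
pose J i := `[c i - C * g i, c i + C * g i]%classic.
have mJ i : measurable (J i) by exact: measurable_itv.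
have mUJ : measurable (\bigcup_i J i) by exact: bigcupT_measurable.
exists (\bigcup_i J i); split => //.
  apply: (le_trans (generalized_Boole_inequality mu mJ mUJ)).
  rewrite (_ : (fun n => _) = fun n =>
    \sum_(0 <= i < n) ((2 * C)%:E * hausdorff_gauge t (U i)))%E; last first.
    apply/funext => n; apply: eq_bigr => i _.
    have [_ -> _] := hg i; rewrite /J [LHS]lebesgue_measure_cc//.
    by rewrite -EFinM; congr EFin; rewrite mulr2n; ring.
  rewrite nneseriesZl => [|i _]; last exact: hausdorff_gauge_ge0.
  apply: le_trans (lee_wpmul2l _ (ltW sumU)) _; first by rewrite lee_fin mulr_ge0.
  rewrite -EFinM lee_fin mulrA ler_pdivrMr; last lra.
  by rewrite mulrDr mulr1 mulrC lerDl ltW.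
move=> x Ax; have [i _ Ui] := AU x Ax; exists i => //.
by have := hc i x Ax Ui; rewrite /J/= in_itv/= ler_norml; move: (C * g i) => z; lra.
Qed.

(** On [0, 1] distances are at most 1, so h is also t-Hoelder for t < s. If the t-measure vanished,
    two sets of measure at most 1/4 would cover [0, 1]. *)
Lemma hoelder_dim_ge h s C :
  (forall x y, 0 <= x <= 1 -> 0 <= y <= 1 -> `|h x - h y| <= C * `|x - y| `^ s) ->
  (forall z, 0 <= z <= 1 -> exists2 x, 0 <= x <= 1 & h x = z) ->
  (s%:E <= hausdorff_dim (nonzero_deriv_set01 h))%E.
Proof.
move=> hC honto; apply: le_ereal_inf_tmp => _ [t [t0 A0] <-].
rewrite lee_fin leNgt; apply/negP => ts.
have s0 : 0 < s by apply: le_lt_trans ts.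
have hC' x y : 0 <= x <= 1 -> 0 <= y <= 1 -> `|h x - h y| <= `|C| * `|x - y| `^ t.
  move=> x01 y01; have [->|xy] := eqVneq x y.
    by rewrite subrr normr0 mulr_ge0 ?powR_ge0.
  apply: le_trans (hC x y x01 y01) _.
  apply: (@le_trans _ _ (`|C| * `|x - y| `^ s)).
    by rewrite ler_wpM2r ?powR_ge0 ?ler_norm.
  rewrite ler_wpM2l//; apply: ger_powR; last exact: ltW.
  by rewrite normr_gt0 subr_eq0 xy/= ler_norml; lra.
have A01 : nonzero_deriv_set01 h `<=` `[0, 1]%classic by move=> x [].
have e0 : 0 < (4^-1 : R) by [].
have [W1 [mW1 W1e hW1]] := hausdorff_null_hoelder_image t0 (normr_ge0 C) A01 hC' A0 e0.
have [W2 [mW2 W2e hW2]] := zero_deriv_image_null h e0.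
have sub : `[0, 1]%classic `<=` W1 `|` W2.
  move=> z /=; rewrite in_itv/= => /honto[x x01 <-].
  have [dx|ndx] := pselect (has_deriv01 h x 0); first by right; exact: hW2.
  by left; apply: hW1; split => //; rewrite in_itv.
have : (mu `[0%R, 1%R]%classic <= (2^-1 : R)%:E)%E.
  apply: (@le_trans _ _ (mu (W1 `|` W2))).
    by apply: le_measure; rewrite ?inE//; exact: measurableU.
  apply: (le_trans (measureU2 mu mW1 mW2)).
  apply: (le_trans (leeD W1e W2e)).
  by rewrite -EFinD lee_fin; lra.
rewrite lebesgue_measure_itv/= lte_fin ltr01 -EFinB lee_fin; lra.
Qed.

Lemma hausdorff_measure_gt1_eq0 A s : A `<=` `[0, 1]%classic -> 1 < s ->
  hausdorff_measure s A = 0%E.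
Proof.
move=> A01 s1; apply/eqP; rewrite eq_le; apply/andP; split; last first.
  by apply: le_ereal_sup_tmp; exists (hausdorff_content s 1 A);
    [exists 1 => //=|exact: hausdorff_content_ge0].
apply: ge_ereal_sup => _ [d /= d0 <-]; apply/lee_addgt0Pr => e e0; rewrite add0e.
(* With N = n + 1, the N + 1 cells contribute at most (N + 1) / N^s <= 2 / N^(s - 1) <= e. *)
have [n [nd ne]] : exists n : nat, n.+1%:R^-1 <= d /\ 2 / e <= n.+1%:R `^ (s - 1).
  have r0 : 0 < (2 / e) `^ (s - 1)^-1 by apply: powR_gt0; rewrite divr_gt0.
  pose n := Num.Def.truncn (d^-1 + (2 / e) `^ (s - 1)^-1).
  have hn : d^-1 + (2 / e) `^ (s - 1)^-1 < n.+1%:R := truncnS_gt _.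
  have d1 : 0 < d^-1 by rewrite invr_gt0.
  exists n; split; first by rewrite invf_ple ?posrE//; move: hn; lra.
  have -> : 2 / e = ((2 / e) `^ (s - 1)^-1) `^ (s - 1).
    by rewrite -powRrM mulVf ?powRr1// ?divr_ge0 ?(ltW e0)// gt_eqF// subr_gt0.
  apply: ge0_ler_powR; rewrite ?nnegrE//; [lra|exact: ltW|lra].
have N0 : 0 < n.+1%:R :> R by [].
pose U i := if (i < n.+2)%N then [set x : R | i%:R <= x * n.+1%:R < i.+1%:R] else set0.
have dU i : (diam (U i) <= (n.+1%:R^-1 : R)%:E)%E.
  apply: diam_le => x y; rewrite /U; case: ifP => //= _ hx hy.
  rewrite lee_fin -[leRHS]mul1r ler_pdivlMr// -[X in _ * X]ger0_norm// -normrM mulrBl.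
  by move: hx hy; rewrite -!natr1 ler_norml; lra.
apply: ge_ereal_inf; exists (\sum_(0 <= i <oo) hausdorff_gauge s (U i))%E.
  exists U => //; split => [x /A01|i]; last by apply: le_trans (dU i) _; rewrite lee_fin.
  rewrite /= in_itv/= => /(grid_cell n)[i im ci]; exists i => //.
  by rewrite /U im.
rewrite (nneseries_split 0 n.+2) => [|k _]; last exact: hausdorff_gauge_ge0.
rewrite add0n [X in (_ + X)%E]eseries0 ?adde0 => [|i ni _]; last first.
  by rewrite /hausdorff_gauge /U ltnNge ni/= eqxx.
apply: (@le_trans _ _ (\sum_(0 <= i < n.+2) (n.+1%:R^-1 `^ s)%:E)%E).
  apply: lee_sum => i _; rewrite /hausdorff_gauge; case: ifPn => [_|/set0P[x Ux]].
    by rewrite lee_fin powR_ge0.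
  have := diam_ge Ux Ux; have := dU i; rewrite subrr normr0.
  case: (diam (U i)) => [r| |]//=; rewrite !lee_fin => rn r0.
  by apply: ge0_ler_powR; rewrite ?nnegrE//; lra.
rewrite sumEFin lee_fin sumr_const_nat subn0 -(mulr_natl _ n.+2) -(natr1 n.+1).
have N1 : 1 <= n.+1%:R :> R by rewrite ler1n.
move: (n.+1%:R : R) N0 N1 ne => N N0 N1 Ne.
have -> : N^-1 `^ s = N^-1 * (N `^ (s - 1))^-1.
  rewrite -powR_inv1 ?(ltW N0)// -powRrM mulN1r powRN -(mulr_powRB1 (ltW N0)); last lra.
  by rewrite powR_inv1 ?(ltW N0)// invfM.
have Ps : 0 < N `^ (s - 1) by rewrite powR_gt0.
rewrite mulrA ler_pdivrMr// ler_pdivrMr//.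
move: Ne; rewrite ler_pdivrMr//; move: (N `^ _) Ps => P P0; nra.
Qed.

Lemma hausdorff_dim_le1 A : A `<=` `[0, 1]%classic -> (hausdorff_dim A <= 1)%E.
Proof.
move=> A01; apply/lee_addgt0Pr => e e0; apply: ge_ereal_inf.
exists (1 + e)%:E => //; exists (1 + e) => //; split; first lra.
by apply: hausdorff_measure_gt1_eq0 => //; lra.
Qed.
End Dimension.

(** * Dimension bound for the conjugacy, and passage to the limit *)

Lemma conjugacy_dim_ge (R : realType) (b a s : R) (h : R -> R) :
  0 < b -> 0 < a -> 0 < s < 1 ->
  is_conjugacy01 (manneville_pomeau b) (manneville_pomeau a) h ->
  `|b / a - 1| <= (1 - ((1 + s) / 2) `^ a^-1) / 3 ->
  `|b / a - 1| <= (1 - s) / 4 -> `|b / a - 1| <= 7^-1 ->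
  (s%:E <= hausdorff_dim (nonzero_deriv_set01 h))%E.
Proof.
move=> b0 a0 s01 hc B1 B2 B3.
have [C hC] := conjugacy_hoelder b0 a0 s01 hc B1 B2 B3.
have [hh _] := hc; have [hi [_ [_ [g [gm _ _ hg]]]]] := hh.
have mono x y : 0 <= x -> x <= y -> y <= 1 -> h x <= h y.
  move=> x0; rewrite le_eqVlt => /orP[/eqP->//|xy] y1.
  by apply/ltW/hi; rewrite ?in_itv//=; lra.
apply: (@hoelder_dim_ge _ h s C) => [|z z01].
  move=> x y; wlog xy : x y / y <= x => [hw|] x01 y01.
    have [xy|/ltW xy] := leP y x; first exact: hw.
    by rewrite distrC (distrC x); exact: hw.
  have ? : h y <= h x by apply: mono; lra.
  by rewrite !ger0_norm ?subr_ge0//; apply: hC; lra.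
have z' : z \in `[0, 1] by rewrite in_itv.
exists (g z); last exact: hg.
by have := gm z z'; rewrite /= in_itv.
Qed.

Theorem corollary1p2 (R : realType) (alpha : R) (halpha : 0 < alpha)
  (theta : R -> R -> R)
  (htheta : forall beta : R, 0 < beta ->
     is_conjugacy01 (manneville_pomeau beta) (manneville_pomeau alpha)
       (theta beta)) :
  hausdorff_dim (nonzero_deriv_set01 (theta beta))
    @[beta --> within [set beta : R | 0 < beta] alpha^'] --> 1%E.
Proof.
move=> P [e /= e0 Pe].
(* The maximum with 1/2 keeps s positive for large e. *)
pose s := Num.max (1 - e / 2) 2^-1.
have s01 : 0 < s < 1.
  by rewrite lt_max gt_max; apply/andP; split; [apply/orP; right|apply/andP; split]; lra.
have se : 1 - s < e.
  have : 1 - e / 2 <= s by rewrite le_max lexx.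
  lra.
pose eta := Num.min ((1 - ((1 + s) / 2) `^ alpha^-1) / 3) (Num.min ((1 - s) / 4) 7^-1).
have eta0 : 0 < eta.
  rewrite !lt_min; apply/and3P; split; [|lra|lra].
  apply: divr_gt0 => //.
  rewrite subr_gt0 [ltRHS](_ : 1 = 1 `^ alpha^-1); last by rewrite powR1.
  by apply: gt0_ltr_powR; rewrite ?nnegrE ?invr_gt0//; lra.
(* Within this radius |beta / alpha - 1| <= eta, so all three smallness conditions hold. *)
exists (eta * alpha) => /= [|beta]; first exact: mulr_gt0.
rewrite /ball/= => hb _ b0.
have /andP[] : (s%:E <= hausdorff_dim (nonzero_deriv_set01 (theta beta)) <= 1)%E.
  apply/andP; split; last by apply: hausdorff_dim_le1 => x [].
  have hba : `|beta / alpha - 1| <= eta.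
    have -> : beta / alpha - 1 = (beta - alpha) / alpha by field; rewrite gt_eqF.
    by rewrite normrM normfV (gtr0_norm halpha) ler_pdivrMr// distrC ltW.
  have [h1 h2 h3] : [/\ eta <= (1 - ((1 + s) / 2) `^ alpha^-1) / 3,
      eta <= (1 - s) / 4 & eta <= 7^-1].
    by rewrite !ge_min !lexx !orbT.
  by apply: (conjugacy_dim_ge b0 halpha s01 (htheta beta b0)); apply: le_trans hba _.
case: (hausdorff_dim _) => [r| |]//=; rewrite !lee_fin => sr r1.
by apply: Pe; rewrite /ball/= ger0_norm ?subr_ge0//; lra.
Qed.
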